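(* Over $\mathsf{RCA}_0$, $\mathsf{CAC}$ is equivalent to $\mathsf{wGS}^{\mathrm{cl}}$, the statement that every infinite CSC space for which the closure relation exists has an infinite subspace which is indiscrete, or has the initial segment topology, or has the final segment topology, or is $T_1$.
   Context: Work in second-order arithmetic; $\mathbb{N}$ denotes the natural numbers of a (possibly nonstandard) model. A countable second-countable (CSC) space is a tuple $\langle X,\mathcal{U},k\rangle$ where $X\subseteq\mathbb{N}$; $\mathcal{U}=\langle U_n:n\in\mathbb{N}\rangle$ is a sequence of subsets of $X$ such that every $x\in X$ belongs to some $U_n$; and $k:X\times\mathbb{N}\times\mathbb{N}\to\mathbb{N}$ is a function such that whenever $x\in U_m\cap U_n$ we have $x\in U_{k(x,m,n)}\subseteq U_m\cap U_n$. The $U_n$ are the basic open sets; write $U\in\mathcal{U}$ if $U=U_n$ for some $n$. The space is infinite if $X$ is infinite. For $Y\subseteq X$, the subspace $Y$ is the CSC space $\langle Y,\langle U_n\cap Y:n\in\mathbb{N}\rangle,k\rangle$. The closure relation of $\langle X,\mathcal{U},k\rangle$ is the set $\mathrm{cl}\subseteq X^2$ with $\langle y,x\rangle\in\mathrm{cl}$ iff every $U\in\mathcal{U}$ containing $y$ also contains $x$ (''exists'' means exists as a set in the model). A CSC space is: indiscrete if every $U\in\mathcal{U}$ is $\emptyset$ or $X$; has the initial segment topology if $X$ is infinite and there is a bijection $h:\mathbb{N}\to X$ such that $U\in\mathcal{U}$ iff $U$ is $\emptyset$, $X$, or $\{h(i):i\le j\}$ for some $j$; has the final segment topology if likewise with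 $\{h(i):i\ge j\}$; is $T_1$ if for all $x\ne y$ in $X$ there are $U,V\in\mathcal{U}$ with $x\in U\setminus V$, $y\in V\setminus U$. $\mathsf{CAC}$ is the statement that every infinite partial order has an infinite chain or an infinite antichain.
   Formalization: In the initial and final segment topologies, ∅ and X are not required to be among the basic open sets U_n; with the literal requirement the claim fails in the standard model for X = ℕ, U_n = {0,…,n}. *)

(* Defs.v *)
(** * Second-order arithmetic *)

(* Henkin structures for the two-sorted language of second-order arithmetic.
   The numbers may be nonstandard. Equality of numbers is [=]; equality of sets
   is not primitive, and always means having the same elements. *)
Record L2_structure : Type := {
  num : Type;
  set : Type;
  zero : num;
  one : num;
  add : num -> num -> num;
  mul : num -> num -> num;
  lt : num -> num -> Prop;
  mem : num -> set -> Prop;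
  set_nonempty : inhabited set
}.

Arguments zero {_}.
Arguments one {_}.
Arguments add {_} _ _.
Arguments mul {_} _ _.
Arguments lt {_} _ _.
Arguments mem {_} _ _.

Declare Scope L2_scope.
Delimit Scope L2_scope with L2.
Bind Scope L2_scope with num.
Infix "+" := add : L2_scope.
Infix "*" := mul : L2_scope.
Infix "<" := lt : L2_scope.
Notation "n ∈ X" := (mem n X) (at level 70, no associativity) : L2_scope.
Open Scope L2_scope.

Inductive term : Type :=
| TVar (i : nat)
| TZero
| TOne
| TAdd (s t : term)
| TMul (s t : term).

(* Number variables are de Bruijn indices, set variables are plain indices:
   a bounded formula has no set quantifiers. *)
Inductive bounded_formula : Type :=
| FEq (s t : term)
| FLt (s t : term)
| FMem (t : term) (X : nat)
| FNot (p : bounded_formula)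
| FAnd (p q : bounded_formula)
| FOr (p q : bounded_formula)
| FImp (p q : bounded_formula)
| FAllLt (t : term) (p : bounded_formula)
| FExLt (t : term) (p : bounded_formula).

Definition scons {A : Type} (a : A) (v : nat -> A) (i : nat) : A :=
  match i with
  | O => a
  | S j => v j
  end.

Fixpoint eval {M : L2_structure} (v : nat -> num M) (t : term) : num M :=
  match t with
  | TVar i => v i
  | TZero => zero
  | TOne => one
  | TAdd s t => eval v s + eval v t
  | TMul s t => eval v s * eval v t
  end.

(* The bounding term is evaluated outside the quantifier, so the bound variable
   does not occur in it. *)
Fixpoint sat {M : L2_structure} (V : nat -> set M) (v : nat -> num M)
    (p : bounded_formula) : Prop :=
  match p with
  | FEq s t => eval v s = eval v t
  | FLt s t => eval v s < eval v t
  | FMem t X => eval v t ∈ V X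
  | FNot p => ~ sat V v p
  | FAnd p q => sat V v p /\ sat V v q
  | FOr p q => sat V v p \/ sat V v q
  | FImp p q => sat V v p -> sat V v q
  | FAllLt t p => forall a, a < eval v t -> sat V (scons a v) p
  | FExLt t p => exists a, a < eval v t /\ sat V (scons a v) p
  end.

(* [sat_Sigma V v p n] is the Sigma^0_1 formula [exists m, p(m, n)], and
   [sat_Pi V v p n] the Pi^0_1 formula [forall m, p(m, n)], with parameters
   [V] and [v]: in [p], index 0 is [m] and index 1 is [n]. *)
Definition sat_Sigma {M : L2_structure} (V : nat -> set M) (v : nat -> num M)
    (p : bounded_formula) (n : num M) : Prop :=
  exists m, sat V (scons m (scons n v)) p.

Definition sat_Pi {M : L2_structure} (V : nat -> set M) (v : nat -> num M)
    (p : bounded_formula) (n : num M) : Prop :=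
  forall m, sat V (scons m (scons n v)) p.

Record basic_axioms (M : L2_structure) : Prop := {
  succ_neq_zero : forall n : num M, n + one <> zero;
  succ_inj : forall m n : num M, m + one = n + one -> m = n;
  add_zero : forall m : num M, m + zero = m;
  add_succ : forall m n : num M, m + (n + one) = (m + n) + one;
  mul_zero : forall m : num M, m * zero = zero;
  mul_succ : forall m n : num M, m * (n + one) = m * n + m;
  not_lt_zero : forall m : num M, ~ m < zero;
  lt_succ : forall m n : num M, m < n + one <-> m < n \/ m = n
}.

Definition Sigma1_induction (M : L2_structure) : Prop :=
  forall (V : nat -> set M) (v : nat -> num M) (p : bounded_formula),
    sat_Sigma V v p zero ->
    (forall n, sat_Sigma V v p n -> sat_Sigma V v p (n + one)) ->
    forall n, sat_Sigma V v p n.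

Definition Delta1_comprehension (M : L2_structure) : Prop :=
  forall (V : nat -> set M) (v : nat -> num M) (p q : bounded_formula),
    (forall n, sat_Sigma V v p n <-> sat_Pi V v q n) ->
    exists X : set M, forall n, n ∈ X <-> sat_Sigma V v p n.

Record RCA0 (M : L2_structure) : Prop := {
  RCA0_basic : basic_axioms M;
  RCA0_induction : Sigma1_induction M;
  RCA0_comprehension : Delta1_comprehension M
}.

(** * Coding *)

Definition le {M : L2_structure} (m n : num M) : Prop := m < n \/ m = n.
Infix "<=" := le : L2_scope.

Definition pair {M : L2_structure} (i j : num M) : num M :=
  (i + j) * (i + j) + i.
Notation "⟨ i , j ⟩" := (pair i j) (at level 0) : L2_scope.
Notation "⟨ i , j , k ⟩" := (pair (pair i j) k) (at level 0) : L2_scope.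

Definition infinite {M : L2_structure} (X : set M) : Prop :=
  forall m, exists n, m < n /\ n ∈ X.

Definition subset {M : L2_structure} (X Y : set M) : Prop :=
  forall n, n ∈ X -> n ∈ Y.
Infix "⊆" := subset (at level 70, no associativity) : L2_scope.

(* [f] is the graph of a function from the class [A] to the class [B]. *)
Definition is_function {M : L2_structure} (f : set M) (A B : num M -> Prop)
    : Prop :=
  (forall z, z ∈ f -> exists a b, A a /\ B b /\ z = ⟨a, b⟩) /\
  (forall a, A a -> exists! b, ⟨a, b⟩ ∈ f).

(* [h] is a bijection from the numbers of the model onto [X]. *)
Definition is_enumeration {M : L2_structure} (h X : set M) : Prop :=
  is_function h (fun _ => True) (fun x => x ∈ X) /\
  (forall i j x, ⟨i, x⟩ ∈ h -> ⟨j, x⟩ ∈ h -> i = j) /\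
  (forall x, x ∈ X -> exists i, ⟨i, x⟩ ∈ h).

(** * The chain-antichain principle *)

Definition is_partial_order {M : L2_structure} (P R : set M) : Prop :=
  (forall z, z ∈ R -> exists x y, x ∈ P /\ y ∈ P /\ z = ⟨x, y⟩) /\
  (forall x, x ∈ P -> ⟨x, x⟩ ∈ R) /\
  (forall x y, ⟨x, y⟩ ∈ R -> ⟨y, x⟩ ∈ R -> x = y) /\
  (forall x y z, ⟨x, y⟩ ∈ R -> ⟨y, z⟩ ∈ R -> ⟨x, z⟩ ∈ R).

Definition is_chain {M : L2_structure} (P R C : set M) : Prop :=
  C ⊆ P /\ forall x y, x ∈ C -> y ∈ C -> ⟨x, y⟩ ∈ R \/ ⟨y, x⟩ ∈ R.

Definition is_antichain {M : L2_structure} (P R C : set M) : Prop :=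
  C ⊆ P /\
  forall x y, x ∈ C -> y ∈ C -> x <> y -> ~ ⟨x, y⟩ ∈ R /\ ~ ⟨y, x⟩ ∈ R.

Definition CAC (M : L2_structure) : Prop :=
  forall P R : set M, is_partial_order P R -> infinite P ->
    exists C : set M, infinite C /\ (is_chain P R C \/ is_antichain P R C).

(** * Countable second-countable spaces *)

(* [nbhds] codes the sequence of the [U_n] through its set of pairs [⟨x, n⟩]
   with [x ∈ U_n]; [wit] is the graph of [k], with arguments [⟨x, m, n⟩]. *)
Record space (M : L2_structure) : Type := {
  points : set M;
  nbhds : set M;
  wit : set M
}.

Arguments points {_} _.
Arguments nbhds {_} _.
Arguments wit {_} _.

Definition in_basic {M : L2_structure} (A : space M) (n x : num M) : Prop :=
  ⟨x, n⟩ ∈ nbhds A.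

Definition wit_domain {M : L2_structure} (A : space M) (z : num M) : Prop :=
  exists x m n, x ∈ points A /\ z = ⟨x, m, n⟩.

Record is_CSC {M : L2_structure} (A : space M) : Prop := {
  CSC_sub : forall n x, in_basic A n x -> x ∈ points A;
  CSC_cover : forall x, x ∈ points A -> exists n, in_basic A n x;
  CSC_wit_function : is_function (wit A) (wit_domain A) (fun _ => True);
  CSC_wit : forall x m n l,
    in_basic A m x -> in_basic A n x -> ⟨⟨x, m, n⟩, l⟩ ∈ wit A ->
    in_basic A l x /\
    forall y, in_basic A l y -> in_basic A m y /\ in_basic A n y
}.

(* [U ∈ 𝒰] *)
Definition is_basic {M : L2_structure} (A : space M) (U : set M) : Prop :=
  exists n, forall x, x ∈ U <-> in_basic A n x.

(* The witness function of a subspace is the restriction of the ambient one. *)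
Definition is_subspace {M : L2_structure} (B A : space M) : Prop :=
  points B ⊆ points A /\
  (forall n x, in_basic B n x <-> in_basic A n x /\ x ∈ points B) /\
  (forall z, z ∈ wit B <->
    z ∈ wit A /\ exists a l, wit_domain B a /\ z = ⟨a, l⟩).

Definition is_closure_relation {M : L2_structure} (A : space M) (cl : set M)
    : Prop :=
  (forall z, z ∈ cl ->
    exists y x, y ∈ points A /\ x ∈ points A /\ z = ⟨y, x⟩) /\
  (forall y x, y ∈ points A -> x ∈ points A ->
    (⟨y, x⟩ ∈ cl <-> forall U, is_basic A U -> y ∈ U -> x ∈ U)).

(* [U] is [∅] or the whole space. *)
Definition is_trivial {M : L2_structure} (A : space M) (U : set M) : Prop :=
  (forall x, ~ x ∈ U) \/ (forall x, x ∈ U <-> x ∈ points A).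

Definition is_indiscrete {M : L2_structure} (A : space M) : Prop :=
  forall U, is_basic A U -> is_trivial A U.

(* In the next two definitions [∅] and the whole space are open by convention
   and need not occur among the [U_n]. Requiring them to occur would exclude,
   for instance, the natural numbers with [U_n = {i : i <= n}], together with
   all infinite subspaces of this space: none has itself as a [U_n]. *)
Definition has_initial_segment_topology {M : L2_structure} (A : space M)
    : Prop :=
  infinite (points A) /\
  exists h : set M, is_enumeration h (points A) /\
    forall U : set M,
      is_trivial A U \/ is_basic A U <->
      is_trivial A U \/
      exists j, forall x, x ∈ U <-> exists i, i <= j /\ ⟨i, x⟩ ∈ h.

Definition has_final_segment_topology {M : L2_structure} (A : space M)
    : Prop :=
  infinite (points A) /\
  exists h : set M, is_enumeration h (points A) /\
    forall U : set M,
      is_trivial A U \/ is_basic A U <->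
      is_trivial A U \/
      exists j, forall x, x ∈ U <-> exists i, j <= i /\ ⟨i, x⟩ ∈ h.

Definition is_T1 {M : L2_structure} (A : space M) : Prop :=
  forall x y, x ∈ points A -> y ∈ points A -> x <> y ->
    exists U V, is_basic A U /\ is_basic A V /\
      (x ∈ U /\ ~ x ∈ V) /\ (y ∈ V /\ ~ y ∈ U).

Definition wGS_cl (M : L2_structure) : Prop :=
  forall A : space M, is_CSC A -> infinite (points A) ->
    (exists cl : set M, is_closure_relation A cl) ->
    exists B : space M, is_subspace B A /\ infinite (points B) /\
      (is_indiscrete B \/ has_initial_segment_topology B \/
       has_final_segment_topology B \/ is_T1 B).

(* Main.v *)
(* From left to right, apply [CAC] three times. Ordering each class of
   topologically indistinguishable points by [<=] gives, as a chain, an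
   indiscrete subspace, or, as an antichain, a subspace on which the closure
   relation is a partial order. For that order an antichain is a T1 subspace.
   On a chain, apply [CAC] to the intersection of the closure relation with
   [<=]: the closure relation agrees with [<=] on a chain and with its reverse
   on an antichain, which gives the two segment topologies once the set is
   enumerated in increasing order. The enumeration counts elements, and the
   computations are coded by divisibility. From right to left, use the
   Alexandrov topology. *)

From Stdlib Require Import List Classical Ring.
Import ListNotations.
Require Import Defs.

(** * Reification of bounded formulas *)

Ltac lookup x l :=
  lazymatch l with
  | x :: _ => constr:(O)
  | _ :: ?l => let i := lookup x l in constr:(S i)
  end.

Ltac reify_term l t :=
  lazymatch t with
  | zero => constr:(TZero)
  | one => constr:(TOne)
  | ?a + ?b => let a := reify_term l a in let b := reify_term l b in constr:(TAdd a b)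
  | ?a * ?b => let a := reify_term l a in let b := reify_term l b in constr:(TMul a b)
  | pair ?a ?b => let t := eval cbv beta delta [pair] in t in reify_term l t
  | _ => let i := lookup t l in constr:(TVar i)
  end.

(* [l] lists the numbers denoted by the de Bruijn indices, [Xs] the set
   parameters. Bounds must be strict, so that the formula evaluates to [P] by
   conversion. *)
Ltac reify_prop l Xs P :=
  lazymatch P with
  | ?a = ?b => let a := reify_term l a in let b := reify_term l b in constr:(FEq a b)
  | ?a < ?b => let a := reify_term l a in let b := reify_term l b in constr:(FLt a b)
  | ?a ∈ ?X => let a := reify_term l a in let i := lookup X Xs in constr:(FMem a i)
  | ~ ?A => let p := reify_prop l Xs A in constr:(FNot p)
  | ?A /\ ?B =>
      let p := reify_prop l Xs A in let q := reify_prop l Xs B in constr:(FAnd p q)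
  | ?A \/ ?B =>
      let p := reify_prop l Xs A in let q := reify_prop l Xs B in constr:(FOr p q)
  | forall x, x < ?t -> @?Q x =>
      let s := reify_term l t in
      let p := reify_under l Xs Q in constr:(FAllLt s p)
  | exists x, x < ?t /\ @?Q x =>
      let s := reify_term l t in
      let p := reify_under l Xs Q in constr:(FExLt s p)
  | ?A -> ?B =>
      let p := reify_prop l Xs A in let q := reify_prop l Xs B in constr:(FImp p q)
  | _ => let P := eval red in P in reify_prop l Xs P
  end
with reify_under l Xs Q :=
  lazymatch type of Q with
  | ?T -> _ =>
    let x := fresh in
    let f := constr:(fun x : T => ltac:(
      let P := eval cbv beta in (Q x) in
      let p := reify_prop (x :: l) Xs P in exact p)) in
    lazymatch f with fun _ => ?p => p end
  end.

(* For [Q : num M -> num M -> Prop], the formula whose index 0 is the second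
   argument of [Q] and whose index 1 is the first. *)
Ltac reify_binary l Xs Q :=
  lazymatch type of Q with
  | ?T -> _ =>
    let n := fresh in
    let f := constr:(fun n : T => ltac:(
      let R := eval cbv beta in (Q n) in
      let p := reify_under (n :: l) Xs R in exact p)) in
    lazymatch f with fun _ => ?p => p end
  end.

(** * Induction and comprehension for formulas given by their meaning *)

Section Model.

Context (M : L2_structure) (HM : RCA0 M).

Local Notation num := (num M).
Local Notation set := (set M).

(** The sort of sets has no distinguished element, so the default [X0] is a parameter, later
    supplied by [set_nonempty]. *)
Definition set_env (Xs : list set) (X0 : set) (i : nat) : set := nth i Xs X0.
Definition num_env (l : list num) (i : nat) : num := nth i l zero.

(** Trades the syntactic scheme for a predicate: when [p] is reified from [Q], the first hypothesis
    holds by conversion, whatever [X0] is. *)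
Lemma sigma_induction (Xs : list set) (l : list num) (p : bounded_formula)
    (Q : num -> num -> Prop) :
  (forall X0 n m, sat (set_env Xs X0) (scons m (scons n (num_env l))) p <-> Q n m) ->
  (exists m, Q zero m) ->
  (forall n, (exists m, Q n m) -> exists m, Q (n + one) m) ->
  forall n, exists m, Q n m.
Proof.
  intros HQ H0 HS n. destruct (set_nonempty M) as [X0].
  assert (E : forall n, sat_Sigma (set_env Xs X0) (num_env l) p n <-> exists m, Q n m).
  { intros k. split; intros [m Hm]; exists m; apply (HQ X0); exact Hm. }
  apply E. apply (RCA0_induction M HM).
  - apply E, H0.
  - intros k Hk. apply E, HS, E, Hk.
Qed.

Lemma bounded_induction (Xs : list set) (l : list num) (p : bounded_formula)
    (Q : num -> Prop) :
  (forall X0 n m, sat (set_env Xs X0) (scons m (scons n (num_env l))) p <-> Q n) ->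
  Q zero -> (forall n, Q n -> Q (n + one)) -> forall n, Q n.
Proof.
  intros HQ H0 HS n.
  destruct (sigma_induction Xs l p (fun n _ => Q n) HQ) with (n := n) as [_ H]; auto.
  - exists zero. exact H0.
  - intros k [m Hk]. exists m. auto.
Qed.

Lemma delta_comprehension (Xs : list set) (l : list num) (p q : bounded_formula)
    (P Q : num -> num -> Prop) :
  (forall X0 n m, sat (set_env Xs X0) (scons m (scons n (num_env l))) p <-> P n m) ->
  (forall X0 n m, sat (set_env Xs X0) (scons m (scons n (num_env l))) q <-> Q n m) ->
  (forall n, (exists m, P n m) <-> forall m, Q n m) ->
  exists X : set, forall n, n ∈ X <-> exists m, P n m.
Proof.
  intros HP HQ H. destruct (set_nonempty M) as [X0].
  destruct (RCA0_comprehension M HM (set_env Xs X0) (num_env l) p q) as [X HX].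
  - intros n. split.
    + intros [m Hm] k. apply HQ, H. exists m. apply (HP X0), Hm.
    + intros Hn. destruct (H n) as [_ [m Hm]].
      * intros m. apply (HQ X0), Hn.
      * exists m. apply HP, Hm.
  - exists X. intros n. rewrite HX. split; intros [m Hm]; exists m; apply (HP X0), Hm.
Qed.

(** With a dummy leading quantifier, one bounded formula serves as both the Sigma and the Pi
    definition. *)
Lemma bounded_comprehension (Xs : list set) (l : list num) (p : bounded_formula)
    (Q : num -> Prop) :
  (forall X0 n m, sat (set_env Xs X0) (scons m (scons n (num_env l))) p <-> Q n) ->
  exists X : set, forall n, n ∈ X <-> Q n.
Proof.
  intros HQ.
  destruct (delta_comprehension Xs l p p (fun n _ => Q n) (fun n _ => Q n)) as [X HX];
    auto.
  - intros n. split; [intros [_ H] _; exact H | intros H; exists zero; exact (H zero)].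
  - exists X. intros n. rewrite HX.
    split; [intros [_ H]; exact H | intros H; exists zero; exact H].
Qed.

Ltac bounded_ind Xs l :=
  lazymatch goal with
  | |- forall n, @?Q n =>
    let p := reify_binary l Xs (fun n _ : num => Q n) in
    refine (bounded_induction Xs l p Q _ _ _); [reflexivity | cbv beta | cbv beta]
  end.

Ltac sigma_ind Xs l :=
  lazymatch goal with
  | |- forall n, exists m, @?Q n m =>
    let p := reify_binary l Xs Q in
    refine (sigma_induction Xs l p Q _ _ _); [reflexivity | cbv beta | cbv beta]
  end.

Ltac bounded_comp Xs l :=
  lazymatch goal with
  | |- exists X : _, forall n, n ∈ X <-> @?Q n =>
    let p := reify_binary l Xs (fun n _ : num => Q n) in
    refine (bounded_comprehension Xs l p Q _); reflexivity
  end.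

Let Hb := RCA0_basic M HM.

(** * Arithmetic *)

Lemma zero_add (n : num) : zero + n = n.
Proof.
  revert n. bounded_ind (@nil set) (@nil num).
  - apply (add_zero _ Hb).
  - intros n IH. rewrite (add_succ _ Hb), IH. reflexivity.
Qed.

Lemma succ_add (m n : num) : (m + one) + n = (m + n) + one.
Proof.
  revert n. bounded_ind (@nil set) [m].
  - rewrite !(add_zero _ Hb). reflexivity.
  - intros n IH. rewrite !(add_succ _ Hb), IH. reflexivity.
Qed.

Lemma add_comm (m n : num) : m + n = n + m.
Proof.
  revert n. bounded_ind (@nil set) [m].
  - rewrite (add_zero _ Hb), zero_add. reflexivity.
  - intros n IH. rewrite (add_succ _ Hb), succ_add, IH. reflexivity.
Qed.

Lemma add_assoc (k m n : num) : k + (m + n) = (k + m) + n.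
Proof.
  revert n. bounded_ind (@nil set) [k; m].
  - rewrite !(add_zero _ Hb). reflexivity.
  - intros n IH. rewrite !(add_succ _ Hb), IH. reflexivity.
Qed.

Lemma zero_mul (n : num) : zero * n = zero.
Proof.
  revert n. bounded_ind (@nil set) (@nil num).
  - apply (mul_zero _ Hb).
  - intros n IH. rewrite (mul_succ _ Hb), IH. apply (add_zero _ Hb).
Qed.

Lemma succ_mul (m n : num) : (m + one) * n = m * n + n.
Proof.
  revert n. bounded_ind (@nil set) [m].
  - rewrite !(mul_zero _ Hb), (add_zero _ Hb). reflexivity.
  - intros n IH. rewrite !(mul_succ _ Hb), IH, <- !add_assoc. f_equal.
    rewrite !(add_succ _ Hb), (add_comm n m). reflexivity.
Qed.

Lemma mul_comm (m n : num) : m * n = n * m.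
Proof.
  revert n. bounded_ind (@nil set) [m].
  - rewrite (mul_zero _ Hb), zero_mul. reflexivity.
  - intros n IH. rewrite (mul_succ _ Hb), succ_mul, IH. reflexivity.
Qed.

Lemma mul_add (k m n : num) : k * (m + n) = k * m + k * n.
Proof.
  revert n. bounded_ind (@nil set) [k; m].
  - rewrite (mul_zero _ Hb), !(add_zero _ Hb). reflexivity.
  - intros n IH. rewrite (add_succ _ Hb), !(mul_succ _ Hb), IH, add_assoc. reflexivity.
Qed.

Lemma mul_assoc (k m n : num) : k * (m * n) = (k * m) * n.
Proof.
  revert n. bounded_ind (@nil set) [k; m].
  - rewrite !(mul_zero _ Hb). reflexivity.
  - intros n IH. rewrite !(mul_succ _ Hb), mul_add, IH. reflexivity.
Qed.

Lemma one_mul (n : num) : one * n = n.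
Proof.
  rewrite <- (zero_add one), succ_mul, zero_mul. apply zero_add.
Qed.

Lemma num_semi_ring : semi_ring_theory (zero : num) one add mul eq.
Proof.
  constructor; intros; auto using zero_add, add_comm, add_assoc, one_mul, zero_mul,
    mul_comm, mul_assoc.
  rewrite !(mul_comm _ p). apply mul_add.
Qed.

Add Ring num_ring : num_semi_ring.

Lemma zero_or_succ (n : num) : n = zero \/ exists k, n = k + one.
Proof.
  (* The disjunction goes under the quantifier, so that the induction formula is Sigma^0_1. *)
  cut (exists k, n = zero \/ n = k + one).
  { intros [k [H | H]]; eauto. }
  revert n. sigma_ind (@nil set) (@nil num).
  - exists zero. auto.
  - intros n _. exists n. auto.
Qed.

Lemma add_cancel (k m n : num) : m + k = n + k -> m = n.
Proof.
  revert k. bounded_ind (@nil set) [m; n].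
  - rewrite !(add_zero _ Hb). auto.
  - intros k IH H. apply IH, (succ_inj _ Hb). rewrite <- !(add_succ _ Hb). exact H.
Qed.

Lemma add_eq_zero (m n : num) : m + n = zero -> n = zero.
Proof.
  intros H. destruct (zero_or_succ n) as [E | [k E]]; [exact E | subst n].
  rewrite (add_succ _ Hb) in H. destruct (succ_neq_zero _ Hb _ H).
Qed.

Lemma lt_iff (m n : num) : m < n <-> exists k, n = m + k + one.
Proof.
  split.
  (* The quantifier is pulled in front of the implication, again to get a Sigma^0_1 formula. *)
  - intros H. cut (exists k, m < n -> n = m + k + one).
    { intros [k Hk]. exists k. auto. }
    clear H. revert n. sigma_ind (@nil set) [m].
    + exists zero. intros H. destruct (not_lt_zero _ Hb _ H).
    + intros n [k Hk]. destruct (classic (m < n)) as [H | H].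
      * exists (k + one). intros _. rewrite (Hk H) at 1. ring.
      * exists zero. intros H'. apply (lt_succ _ Hb) in H'.
        destruct H' as [H' | <-]; [contradiction | ring].
  - intros [k ->]. revert k. bounded_ind (@nil set) [m].
    + apply (lt_succ _ Hb). right. ring.
    + intros k IH. apply (lt_succ _ Hb). left. rewrite add_assoc. exact IH.
Qed.

Lemma le_iff (m n : num) : m <= n <-> exists k, n = m + k.
Proof.
  unfold le. rewrite lt_iff. split.
  - intros [[k ->] | ->]; [exists (k + one) | exists zero]; ring.
  - intros [k ->]. destruct (zero_or_succ k) as [-> | [j ->]].
    + right. ring.
    + left. exists j. ring.
Qed.

Lemma lt_succ_le (m n : num) : m < n + one <-> m <= n.
Proof. apply (lt_succ _ Hb). Qed.

Lemma lt_irrefl (n : num) : ~ n < n.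
Proof.
  rewrite lt_iff. intros [k Hk]. apply (succ_neq_zero _ Hb k), (add_cancel n).
  rewrite Hk at 2. ring.
Qed.

Lemma le_refl (n : num) : n <= n.
Proof. right. reflexivity. Qed.

Lemma le_trans (k m n : num) : k <= m -> m <= n -> k <= n.
Proof.
  rewrite !le_iff. intros [i ->] [j ->]. exists (i + j). ring.
Qed.

Lemma lt_le_trans (k m n : num) : k < m -> m <= n -> k < n.
Proof.
  rewrite le_iff, !lt_iff. intros [i ->] [j ->]. exists (i + j). ring.
Qed.

Lemma le_lt_trans (k m n : num) : k <= m -> m < n -> k < n.
Proof.
  rewrite le_iff, !lt_iff. intros [i ->] [j ->]. exists (i + j). ring.
Qed.

Lemma le_or_lt (m n : num) : m <= n \/ n < m.
Proof.
  revert n. change (forall n, (m < n \/ m = n) \/ n < m).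
  bounded_ind (@nil set) [m].
  - destruct (zero_or_succ m) as [-> | [k ->]]; auto.
    right. apply lt_iff. exists k. ring.
  - intros n [H | H].
    + left. left. apply (lt_succ _ Hb). exact H.
    + apply lt_iff in H. destruct H as [k ->].
      destruct (zero_or_succ k) as [-> | [j ->]].
      * left. right. ring.
      * right. apply lt_iff. exists j. ring.
Qed.

Lemma lt_or_gt (m n : num) : m <> n -> m < n \/ n < m.
Proof.
  destruct (le_or_lt m n) as [[H | H] | H]; tauto.
Qed.

Lemma lt_add_one (n : num) : n < n + one.
Proof. apply lt_succ_le, le_refl. Qed.

Lemma zero_le (n : num) : zero <= n.
Proof. apply le_iff. exists n. ring. Qed.

Lemma le_succ_lt (m n : num) : m < n -> m + one <= n.
Proof. rewrite lt_iff, le_iff. intros [k ->]. exists k. ring. Qed.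

Lemma le_add_l (m n : num) : m <= m + n.
Proof. apply le_iff. eauto. Qed.

Lemma add_le (a b c d : num) : a <= c -> b <= d -> a + b <= c + d.
Proof.
  rewrite !le_iff. intros [i ->] [j ->]. exists (i + j). ring.
Qed.

Lemma mul_le (a b c d : num) : a <= c -> b <= d -> a * b <= c * d.
Proof.
  rewrite !le_iff. intros [i ->] [j ->]. exists (i * b + a * j + i * j). ring.
Qed.

(** * The pairing function, least elements and sets of pairs *)

Lemma pair_mono (a b c d : num) : a <= c -> b <= d -> ⟨a, b⟩ <= ⟨c, d⟩.
Proof. unfold pair. auto using add_le, mul_le. Qed.

(** These bounds let quantifiers over the components of a pair count as bounded. *)
Lemma pair_bounds (i j : num) : i < ⟨i, j⟩ + one /\ j < ⟨i, j⟩ + one.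
Proof.
  rewrite !lt_succ_le, !le_iff. split.
  - exists ((i + j) * (i + j)). unfold pair. ring.
  - destruct (zero_or_succ j) as [-> | [k ->]].
    + exists ⟨i, zero⟩. ring.
    (* The witness is [⟨i, k + one⟩] minus [k + one], expanded. *)
    + exists (i * i + i * k + i + k * i + k * k + k + i + i). unfold pair. ring.
Qed.

(** Pairs with sum [s] have codes from [s * s] to [s * s + s], below the square of [s + one]. *)
Lemma pair_lt (i j i' j' : num) : i + j < i' + j' -> ⟨i, j⟩ < ⟨i', j'⟩.
Proof.
  rewrite !lt_iff. intros [k H]. unfold pair. rewrite H.
  exists ((i + j) * (k + k + one) + j + k * k + k + k + i'). ring.
Qed.

Lemma pair_inj (i j i' j' : num) : ⟨i, j⟩ = ⟨i', j'⟩ -> i = i' /\ j = j'.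
Proof.
  intros H.
  assert (E : i + j = i' + j').
  { destruct (classic (i + j = i' + j')) as [E | E]; [exact E | exfalso].
    destruct (lt_or_gt _ _ E) as [L | L]; apply pair_lt in L; rewrite H in L;
      exact (lt_irrefl _ L). }
  unfold pair in H. rewrite E in H.
  assert (Ei : i = i').
  { apply (add_cancel ((i' + j') * (i' + j'))). rewrite !(add_comm _ (_ * _)). exact H. }
  subst i'. split; [reflexivity |].
  apply (add_cancel i). rewrite !(add_comm _ i). exact E.
Qed.

Lemma triple_inj (a b c a' b' c' : num) :
  ⟨a, b, c⟩ = ⟨a', b', c'⟩ -> a = a' /\ b = b' /\ c = c'.
Proof.
  intros H. apply pair_inj in H. destruct H as [H ->]. apply pair_inj in H. tauto.
Qed.

Lemma least_element (X : set) :
  (exists n, n ∈ X) -> exists n, n ∈ X /\ forall m, m < n -> ~ m ∈ X.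
Proof.
  intros [n Hn]. apply NNPP. intros H.
  assert (A : forall n, forall m, m < n -> ~ m ∈ X).
  { bounded_ind [X] (@nil num).
    - intros m Hm. destruct (not_lt_zero _ Hb _ Hm).
    - intros k IH m Hm Hx. apply (lt_succ _ Hb) in Hm. destruct Hm as [Hm | ->].
      + exact (IH m Hm Hx).
      + apply H. eauto. }
  exact (A (n + one) n (lt_add_one n) Hn).
Qed.

(** The premise bounds both components by the code, so [bounded_comp] discharges it whenever [Q] is
    bounded. *)
Lemma relation_comprehension (Q : num -> num -> Prop) :
  (exists X : set, forall z, z ∈ X <->
    exists x, x < z + one /\ exists y, y < z + one /\ z = ⟨x, y⟩ /\ Q x y) ->
  exists X : set, (forall z, z ∈ X -> exists x y, z = ⟨x, y⟩ /\ Q x y) /\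
    forall x y, ⟨x, y⟩ ∈ X <-> Q x y.
Proof.
  intros [X HX]. exists X. split.
  - intros z Hz. apply HX in Hz. destruct Hz as [x [_ [y [_ H]]]]. eauto.
  - intros x y. rewrite HX. split.
    + intros [x' [_ [y' [_ [E H]]]]]. apply pair_inj in E. destruct E as [-> ->]. exact H.
    + intros H. destruct (pair_bounds x y). exists x. split; [assumption |].
      exists y. auto.
Qed.

(** * Counting the elements of a set *)

(* [⟨a, b⟩] codes the set of the [z] below a given bound such that
   [1 + (z + 1) b] divides [a]. If [b] is divisible by all small positive
   numbers then these divisors are pairwise coprime. *)
Definition codes (a b z : num) : Prop :=
  exists c, c < a + one /\ a = c * (one + (z + one) * b).

(** The divisor is at least 1, so the bound on the quotient is automatic; it makes [codes] a bounded
    formula. *)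
Lemma codes_iff (a b z : num) : codes a b z <-> exists c, a = c * (one + (z + one) * b).
Proof.
  split.
  - intros [c [_ H]]. eauto.
  - intros [c H]. exists c. split; [| exact H].
    apply lt_succ_le, le_iff. exists (c * (z + one) * b). rewrite H. ring.
Qed.

(** Each modulus is at least 2. Thus [one] codes the empty set. *)
Lemma codes_one (b z : num) : zero < b -> ~ codes one b z.
Proof.
  intros H Hc. apply lt_iff in H. destruct H as [l ->].
  apply codes_iff in Hc. destruct Hc as [c Hc].
  assert (N : forall k : num, one <> (k + one) + one).
  { intros k E. apply (succ_neq_zero _ Hb k), (add_cancel one).
    rewrite <- E. ring. }
  destruct (zero_or_succ c) as [-> | [k ->]].
  - apply (succ_neq_zero _ Hb zero). rewrite zero_add, Hc. ring.
  - apply (N (k + k * (z + one) * (l + one) + z * (l + one) + l)).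
    refine (eq_trans Hc _). ring.
Qed.

(** The quotient is [y - x] if [x <= y]; otherwise the equation forces [a] to be zero. *)
Lemma divides_sub (p x y a : num) : p * x + a = p * y -> exists c, a = c * p.
Proof.
  intros H. destruct (le_or_lt x y) as [L | L].
  - apply le_iff in L. destruct L as [k ->]. exists k.
    apply (add_cancel (p * x)). rewrite (add_comm a), H. ring.
  - apply lt_iff in L. destruct L as [k ->]. exists zero.
    transitivity (zero : num); [| ring].
    apply (add_eq_zero (p * (k + one))), (add_cancel (p * y)).
    rewrite zero_add. refine (eq_trans _ H). ring.
Qed.

(** Induction on the existence of a common multiple replaces the factorial, whose definition would
    itself require coded recursion. *)
Lemma common_multiple (n : num) :
  exists b, zero < b /\ forall d, d < n -> exists q, q < b + one /\ b = (d + one) * q.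
Proof.
  revert n. sigma_ind (@nil set) (@nil num).
  - exists one. split.
    + apply lt_iff. exists zero. ring.
    + intros d Hd. destruct (not_lt_zero _ Hb _ Hd).
  - intros n [b [Hpos H]]. exists (b * (n + one)). split.
    + apply (lt_le_trans _ b); [exact Hpos |]. apply le_iff. exists (b * n). ring.
    + intros d Hd. apply (lt_succ _ Hb) in Hd. destruct Hd as [Hd | ->].
      * destruct (H d Hd) as [q [Hq E]]. exists (q * (n + one)). split.
        -- apply lt_succ_le, mul_le; [apply lt_succ_le, Hq | apply le_refl].
        -- rewrite E. ring.
      * exists b. split; [| ring]. apply lt_succ_le, le_iff. exists (b * n). ring.
Qed.

(** Distinct moduli are coprime, so that of [z] divides the product only if it already divides [a].
    This is how a coded set gains an element. *)
Lemma codes_insert (n a b w z : num) :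
  (forall d, d < n -> exists q, q < b + one /\ b = (d + one) * q) ->
  w < n -> z < n ->
  codes (a * (one + (w + one) * b)) b z <-> codes a b z \/ z = w.
Proof.
  intros Hdiv Hw Hz. rewrite !codes_iff. split.
  - intros [c Hc]. destruct (classic (z = w)) as [E | E]; [auto | left].
    (* If [z + d = w] and [b = d e] then
       [(z + 1)^2 e (1 + (w + 1) b) + (1 + (z + 1) b)
         = 1 + (z + 1) (w + 1) e (1 + (z + 1) b)],
       so [1 + (w + 1) b] is invertible modulo [1 + (z + 1) b]; similarly if
       [z = w + d]. *)
    destruct (lt_or_gt _ _ E) as [L | L]; apply lt_iff in L; destruct L as [d E'].
    + destruct (Hdiv d) as [e [_ He]].
      { apply (le_lt_trans _ w); [| exact Hw]. apply le_iff. exists (z + one).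
        rewrite E'. ring. }
      apply (divides_sub _ (a * (z + one) * (w + one) * e)
        (a + c * (z + one) * (z + one) * e)).
      transitivity (a * (one + (z + one) * b)
        + (z + one) * (z + one) * e * (c * (one + (z + one) * b))); [| ring].
      rewrite <- Hc, He, E'. ring.
    + destruct (Hdiv d) as [e [_ He]].
      { apply (le_lt_trans _ z); [| exact Hz]. apply le_iff. exists (w + one).
        rewrite E'. ring. }
      apply (divides_sub _ (c * (z + one) * (z + one) * e)
        (a * (z + one) * (w + one) * e + a)).
      transitivity ((z + one) * (z + one) * e * (c * (one + (z + one) * b)) + a); [ring |].
      rewrite <- Hc, He, E'. ring.
  - intros [[c ->] | ->].
    + exists (c * (one + (w + one) * b)). ring.
    + eauto.
Qed.

(* [j] and [k] are the numbers of elements of [Z] below [y] and [y + 1]. *)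
Definition next_count (Z : set) (y j k : num) : Prop :=
  (y ∈ Z /\ k = j + one) \/ (~ y ∈ Z /\ k = j).

Lemma next_count_exists (Z : set) (y j : num) :
  exists k, k < j + one + one /\ next_count Z y j k.
Proof.
  destruct (classic (y ∈ Z)) as [H | H].
  - exists (j + one). split; [apply lt_add_one | left; auto].
  - exists j. split; [| right; auto].
    apply lt_succ_le. left. apply lt_add_one.
Qed.

Lemma next_count_unique (Z : set) (y j k k' : num) :
  next_count Z y j k -> next_count Z y j k' -> k = k'.
Proof.
  intros [[H ->] | [H ->]] [[H' ->] | [H' ->]]; tauto.
Qed.

(** An entry [⟨j, y⟩] is meant to record that [j] elements of [Z] lie below [y]. The code contains
    the counting computation up to [x], and possibly more. *)
Definition closed (Z : set) (x a b : num) : Prop :=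
  codes a b ⟨zero, zero⟩ /\
  forall y, y < x -> forall j, j < y + one -> codes a b ⟨j, y⟩ ->
    forall k, k < j + one + one -> next_count Z y j k -> codes a b ⟨k, y + one⟩.

(** Rules out rival counts in the columns up to [x]. Only counts up to [y] matter in column [y], as
    only [y] numbers lie below [y]. *)
Definition functional (x a b : num) : Prop :=
  forall y, y < x + one -> forall i, i < y + one -> forall j, j < y + one ->
    codes a b ⟨i, y⟩ -> codes a b ⟨j, y⟩ -> i = j.

Lemma closed_mono (Z : set) (x y a b : num) : x <= y -> closed Z y a b -> closed Z x a b.
Proof.
  intros L [H0 H]. split; [exact H0 |].
  intros z Hz. apply H, (lt_le_trans _ x); assumption.
Qed.

(* The graph of the counting function below [n] is coded, by induction on the
   part of it that has been coded already. *)
Lemma count_code (Z : set) (n : num) :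
  exists a b, closed Z n a b /\ functional n a b /\
    exists i, i < n + one /\ codes a b ⟨i, n⟩.
Proof.
  (* Every [⟨j, y⟩] with [j <= y <= n] is at most [⟨n, n⟩], so one [b] serves for the whole
     induction. *)
  destruct (common_multiple (⟨n, n⟩ + one)) as [b [Hpos Hdiv]].
  assert (Hsmall : forall j y, j < y + one -> y < n + one -> ⟨j, y⟩ < ⟨n, n⟩ + one).
  { intros j y Hj Hy. apply lt_succ_le in Hj, Hy. apply lt_succ_le, pair_mono;
      eauto using le_trans. }
  (* The third clause leaves the columns after [x] empty, so that one new entry in column [x + one]
     cannot break functionality. *)
  cut (forall x, exists a, x < n + one -> closed Z x a b /\ functional n a b /\
    (forall y, y < n + one -> forall j, j < y + one -> codes a b ⟨j, y⟩ -> y < x + one) /\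
    exists i, i < x + one /\ codes a b ⟨i, x⟩).
  { intros H. destruct (H n) as [a Ha]. destruct (Ha (lt_add_one n)) as [Hc [Hf [_ Hi]]].
    exists a, b. auto. }
  sigma_ind [Z] [b; n].
  (* Start from [one], the code of the empty set, and insert [⟨zero, zero⟩]. *)
  - exists (one * (one + (⟨zero, zero⟩ + one) * b)). intros _.
    assert (F : forall j y, j < y + one -> y < n + one ->
      codes (one * (one + (⟨zero, zero⟩ + one) * b)) b ⟨j, y⟩ <-> j = zero /\ y = zero).
    { intros j y Hj Hy. rewrite (codes_insert (⟨n, n⟩ + one)); auto.
      - split.
        + intros [H | H]; [destruct (codes_one _ _ Hpos H) | apply pair_inj, H].
        + intros [-> ->]. auto.
      - apply lt_succ_le, pair_mono; apply zero_le. }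
    assert (P : forall k : num, zero < k + one) by (intros k; apply lt_succ_le, zero_le).
    repeat split.
    + apply F; auto.
    + intros y Hy. destruct (not_lt_zero _ Hb _ Hy).
    + intros y Hy i Hi j Hj Ci Cj. apply F in Ci, Cj; auto. destruct Ci, Cj. congruence.
    + intros y Hy j Hj Cj. apply F in Cj; auto. destruct Cj as [_ ->]. auto.
    + exists zero. split; [auto | apply F; auto].
  - intros x [a IH]. destruct (classic (x + one < n + one)) as [Hx' | Hx'].
    (* Past [n] the claim is vacuous and any number serves. *)
    2: { exists a. intros H. contradiction. }
    assert (Hx : x < n + one).
    { apply (lt_le_trans _ (x + one)); [apply lt_add_one | left; exact Hx']. }
    destruct (IH Hx) as [Hcl [Hf [Hle [i [Hi Ci]]]]].
    destruct (next_count_exists Z x i) as [i' [Hi' Hn]].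
    assert (Hi'x : i' < x + one + one).
    { apply (lt_le_trans _ (i + one + one)); [exact Hi' |].
      apply add_le; [apply le_succ_lt, Hi | apply le_refl]. }
    exists (a * (one + (⟨i', x + one⟩ + one) * b)). intros _.
    assert (F : forall j y, j < y + one -> y < n + one ->
      codes (a * (one + (⟨i', x + one⟩ + one) * b)) b ⟨j, y⟩ <->
      codes a b ⟨j, y⟩ \/ (j = i' /\ y = x + one)).
    { intros j y Hj Hy. rewrite (codes_insert (⟨n, n⟩ + one)); auto. split.
      - intros [H | H]; [auto | apply pair_inj in H; auto].
      - intros [H | [-> ->]]; auto. }
    assert (Hnew : forall j, j < x + one + one -> ~ codes a b ⟨j, x + one⟩).
    { intros j Hj Cj. apply (lt_irrefl (x + one)). eapply Hle; eauto. }
    assert (P : forall k : num, zero < k + one) by (intros k; apply lt_succ_le, zero_le).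
    repeat split.
    + apply F; auto. left. apply Hcl.
    + intros y Hy j Hj Cj k Hk Hjk.
      assert (Hyx : y <= x) by (apply lt_succ_le, Hy).
      assert (Hyn : y < n + one) by eauto using le_lt_trans.
      apply F; auto.
      { apply (lt_le_trans _ (j + one + one)); [exact Hk |].
        apply add_le; [apply le_succ_lt, Hj | apply le_refl]. }
      { apply (le_lt_trans _ (x + one)); [| exact Hx'].
        apply add_le; [exact Hyx | apply le_refl]. }
      apply F in Cj; auto. destruct Cj as [Cj | [_ ->]].
      2: { destruct (lt_irrefl _ Hy). }
      (* Before column [x] the old code is closed; in column [x] the only count is [i], and its
         successor has just been inserted. *)
      destruct Hyx as [Hyx | ->].
      * left. apply (proj2 Hcl) with j; auto.
      * right. split; [| reflexivity].
        rewrite (Hf x Hx j Hj i Hi Cj Ci) in Hjk. eapply next_count_unique; eauto.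
    + intros y Hy j Hj k Hk Cj Ck. apply F in Cj, Ck; auto.
      destruct Cj as [Cj | [-> Ey]]; destruct Ck as [Ck | [-> Ey']].
      * apply (Hf y); auto.
      * subst y. destruct (Hnew j Hj Cj).
      * subst y. destruct (Hnew k Hk Ck).
      * reflexivity.
    + intros y Hy j Hj Cj. apply F in Cj; auto. destruct Cj as [Cj | [_ ->]].
      * apply lt_succ_le. left. eapply Hle; eauto.
      * apply lt_add_one.
    + exists i'. split; [exact Hi'x |]. apply F; auto.
Qed.

(** Both codes start with [⟨zero, zero⟩] and follow the same steps, so they share an entry in every
    column up to [x]. In column [x] functionality identifies it with [i]. *)
Lemma closed_functional_agree (Z : set) (x i a b a' b' : num) :
  closed Z x a b -> closed Z x a' b' -> functional x a' b' ->
  i < x + one -> codes a' b' ⟨i, x⟩ -> codes a b ⟨i, x⟩.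
Proof.
  intros Hc Hc' Hf Hi Ci.
  assert (A : forall y, y < x + one ->
    exists j, j < y + one /\ codes a b ⟨j, y⟩ /\ codes a' b' ⟨j, y⟩).
  { bounded_ind (@nil set) [x; a; b; a'; b'].
    - intros _. exists zero. split; [apply lt_add_one |]. split; [apply Hc | apply Hc'].
    - intros y IH Hy. assert (Hyx : y < x).
      { apply (lt_le_trans _ (y + one)); [apply lt_add_one | apply lt_succ_le, Hy]. }
      destruct IH as [j [Hj [C C']]]; [apply lt_succ_le; left; exact Hyx |].
      destruct (next_count_exists Z y j) as [k [Hk Hn]].
      exists k. split; [| split].
      + apply (lt_le_trans _ (j + one + one)); [exact Hk |].
        apply add_le; [apply le_succ_lt, Hj | apply le_refl].
      + apply (proj2 Hc) with j; auto.
      + apply (proj2 Hc') with j; auto. }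
  destruct (A x (lt_add_one x)) as [j [Hj [C C']]].
  rewrite (Hf x (lt_add_one x) i Hi j Hj Ci C'). exact C.
Qed.

(** [⟨i, x⟩ ∈ G] says that [Z] has [i] elements below [x]. Lying in some closed functional code is
    Sigma^0_1, lying in every closed code is Pi^0_1, and the two agree by [closed_functional_agree]
    and [count_code]. *)
Lemma count_graph (Z : set) :
  exists G : set,
    (forall x, exists i, ⟨i, x⟩ ∈ G) /\
    (forall x i j, ⟨i, x⟩ ∈ G -> ⟨j, x⟩ ∈ G -> i = j) /\
    ⟨zero, zero⟩ ∈ G /\
    (forall i x k, ⟨i, x⟩ ∈ G -> next_count Z x i k -> ⟨k, x + one⟩ ∈ G).
Proof.
  set (P := fun i x a b : num =>
    closed Z x a b /\ functional x a b /\ i < x + one /\ codes a b ⟨i, x⟩).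
  (* A single [m] bounds both [a] and [b], which leaves one unbounded quantifier. *)
  set (Sig := fun n m : num => exists a, a < m /\ exists b, b < m /\
    exists i, i < n + one /\ exists x, x < n + one /\ n = ⟨i, x⟩ /\ P i x a b).
  set (Pi := fun n m : num => exists i, i < n + one /\ exists x, x < n + one /\
    n = ⟨i, x⟩ /\ i < x + one /\
    forall a, a < m -> forall b, b < m -> closed Z x a b -> codes a b ⟨i, x⟩).
  assert (B : forall a b : num, exists m, a < m /\ b < m).
  { intros a b. exists (a + b + one). split; apply lt_succ_le.
    - apply le_add_l.
    - rewrite add_comm. apply le_add_l. }
  assert (E : exists G : set, forall n, n ∈ G <-> exists m, Sig n m).
  { let p := reify_binary (@nil num) [Z] Sig in
    let q := reify_binary (@nil num) [Z] Pi in
    apply (delta_comprehension [Z] (@nil num) p q Sig Pi); [reflexivity | reflexivity |].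
    intros n. split.
    - intros [_ [a [_ [b [_ [i [Hi [x [Hx [-> [Hc [Hf [Hix C]]]]]]]]]]]]] m.
      exists i. split; [exact Hi |]. exists x. split; [exact Hx |].
      split; [reflexivity |]. split; [exact Hix |].
      intros a' _ b' _ Hc'. exact (closed_functional_agree Z x i a' b' a b Hc' Hc Hf Hix C).
    - intros H. destruct (H zero) as [i [Hi [x [Hx [-> [Hix _]]]]]].
      destruct (count_code Z x) as [a [b [Hc [Hf _]]]].
      destruct (B a b) as [m [Ha Hb']]. exists m.
      exists a. split; [exact Ha |]. exists b. split; [exact Hb' |].
      exists i. split; [exact Hi |]. exists x. split; [exact Hx |].
      split; [reflexivity |]. split; [exact Hc |]. split; [exact Hf |].
      split; [exact Hix |].
      destruct (H m) as [i' [_ [x' [_ [E' [_ Hall]]]]]].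
      apply pair_inj in E'. destruct E' as [<- <-]. apply Hall; assumption. }
  destruct E as [G HG].
  assert (HP : forall i x, ⟨i, x⟩ ∈ G <-> exists a b, P i x a b).
  { intros i x. rewrite HG. split.
    - intros [m [a [_ [b [_ [i' [_ [x' [_ [E' H]]]]]]]]]].
      apply pair_inj in E'. destruct E' as [-> ->]. eauto.
    - intros [a [b H]]. destruct (B a b) as [m [Ha Hb']]. exists m.
      destruct (pair_bounds i x).
      exists a. split; [exact Ha |]. exists b. split; [exact Hb' |].
      exists i. split; [assumption |]. exists x. auto. }
  clear HG. exists G.
  assert (T : forall x, exists i, ⟨i, x⟩ ∈ G).
  { intros x. destruct (count_code Z x) as [a [b [Hc [Hf [i [Hi C]]]]]].
    exists i. apply HP. exists a, b. repeat split; auto; apply Hc. }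
  repeat split.
  - exact T.
  - intros x i j Hi Hj. apply HP in Hi, Hj.
    destruct Hi as [a [b [Hc [Hf [Hi C]]]]]. destruct Hj as [a' [b' [Hc' [Hf' [Hj C']]]]].
    apply (Hf x (lt_add_one x)); auto.
    eapply closed_functional_agree; eauto.
  - destruct (T zero) as [i Hi]. assert (Hi0 := Hi). apply HP in Hi0.
    destruct Hi0 as [a [b [_ [_ [H _]]]]]. apply (lt_succ _ Hb) in H.
    destruct H as [H | ->]; [destruct (not_lt_zero _ Hb _ H) | exact Hi].
  - intros i x k Hi Hn. apply HP in Hi. destruct Hi as [a [b [Hc [Hf [Hi C]]]]].
    destruct (count_code Z (x + one)) as [a' [b' [Hc' [Hf' _]]]].
    assert (L : x <= x + one) by apply le_add_l.
    assert (Hk : k < i + one + one).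
    { destruct (next_count_exists Z x i) as [k' [Hk' Hn']].
      rewrite (next_count_unique _ _ _ _ _ Hn Hn'). exact Hk'. }
    apply HP. exists a', b'. split; [exact Hc' |]. split; [exact Hf' |]. split.
    + apply (lt_le_trans _ (i + one + one)); [exact Hk |].
      apply add_le; [apply le_succ_lt, Hi | apply le_refl].
    + apply (proj2 Hc') with i; auto using lt_add_one.
      apply (closed_functional_agree Z x i a' b' a b); eauto using closed_mono.
Qed.

(** The value at [i] is the element of [Z] with exactly [i] elements of [Z] below it, so [h] is the
    counting graph restricted to [Z]. *)
Lemma increasing_enumeration (Z : set) :
  infinite Z -> exists h, is_enumeration h Z /\
    forall i j x y, ⟨i, x⟩ ∈ h -> ⟨j, y⟩ ∈ h -> i < j -> x < y.
Proof.
  intros HZ. destruct (count_graph Z) as [G [GT [GF [G0 GS]]]].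
  assert (In : forall i x, x ∈ Z -> ⟨i, x⟩ ∈ G -> ⟨i + one, x + one⟩ ∈ G).
  { intros i x Hx Hi. apply (GS i x); [exact Hi | left; auto]. }
  assert (Mono : forall x y i j, x <= y -> ⟨i, x⟩ ∈ G -> ⟨j, y⟩ ∈ G -> i <= j).
  { intros x y i j L Hi. apply le_iff in L. destruct L as [k ->]. revert k j.
    (* The count rises by at most one at a time; the bound [i + k] on it keeps the induction formula
       bounded. *)
    assert (Mk : forall k, exists j, j < i + k + one /\ ⟨j, x + k⟩ ∈ G /\ ~ j < i).
    { bounded_ind [G] [i; x].
      - exists i. rewrite !(add_zero _ Hb). auto using lt_irrefl, lt_add_one.
      - intros k [j [Hj [Gj Hij]]]. destruct (next_count_exists Z (x + k) j) as [j' [Hj' Hn]].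
        exists j'. split; [| split].
        + apply (lt_le_trans _ (j + one + one)); [exact Hj' |].
          rewrite (add_succ _ Hb). apply add_le; [apply le_succ_lt, Hj | apply le_refl].
        + rewrite (add_succ _ Hb). eapply GS; eauto.
        + intros H. apply Hij. apply (le_lt_trans _ j'); [| exact H].
          destruct Hn as [[_ ->] | [_ ->]]; [apply le_add_l | apply le_refl]. }
    intros k j Hj. destruct (Mk k) as [j' [_ [Gj' H]]].
    rewrite (GF _ _ _ Hj Gj'). destruct (le_or_lt i j'); tauto. }
  assert (Gap : forall i x y, x <= y -> (forall z, z < y -> x <= z -> ~ z ∈ Z) ->
    ⟨i, x⟩ ∈ G -> ⟨i, y⟩ ∈ G).
  { intros i x y L H Hi. apply le_iff in L. destruct L as [k ->]. revert k H.
    assert (Gk : forall k, (forall z, z < x + k -> ~ z < x -> ~ z ∈ Z) -> ⟨i, x + k⟩ ∈ G).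
    { bounded_ind [G; Z] [i; x].
      - intros _. rewrite (add_zero _ Hb). exact Hi.
      - intros k IH H. rewrite (add_succ _ Hb) in *.
        apply (GS i).
        + apply IH. intros z Hz. apply H, lt_succ_le. left. exact Hz.
        + right. split; [| reflexivity]. apply H; [apply lt_add_one |].
          intros L. apply (lt_irrefl (x + k)).
          apply (lt_le_trans _ x); [exact L | apply le_add_l]. }
    intros k H. apply Gk. intros z Hz Hzx. apply H; [exact Hz |].
    destruct (le_or_lt x z); tauto. }
  assert (Next : forall i x, ⟨i, x⟩ ∈ G -> exists y, y ∈ Z /\ ⟨i, y⟩ ∈ G).
  { intros i x Hi.
    (* The least element of [Z] from [x] on has the same count as [x], by [Gap]. *)
    assert (EY : exists Y : set, forall n, n ∈ Y <-> n ∈ Z /\ ~ n < x)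
      by bounded_comp [Z] [x].
    destruct EY as [Y HY]. destruct (least_element Y) as [y [Hy Hmin]].
    { destruct (HZ x) as [y [L Hy]]. exists y. apply HY. split; [exact Hy |].
      intros L'. apply (lt_irrefl x). eapply lt_le_trans; [exact L | left; exact L']. }
    apply HY in Hy. destruct Hy as [Hy Lxy]. exists y. split; [exact Hy |].
    apply (Gap i x); [destruct (le_or_lt x y); tauto | | exact Hi].
    intros z Hz Lz Zz. apply (Hmin z Hz), HY. split; [exact Zz |].
    intros L. apply (lt_irrefl x). eapply le_lt_trans; eauto. }
  destruct (relation_comprehension (fun i x => x ∈ Z /\ ⟨i, x⟩ ∈ G)) as [h [h1 h2]].
  { bounded_comp [Z; G] (@nil num). }
  assert (Inc : forall i j x y, ⟨i, x⟩ ∈ h -> ⟨j, y⟩ ∈ h -> i < j -> x < y).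
  { intros i j x y Hi Hj L. apply h2 in Hi, Hj.
    destruct (le_or_lt y x) as [L' | L']; [exfalso | exact L'].
    apply (lt_irrefl i). apply (lt_le_trans _ j); [exact L |].
    apply (Mono y x); tauto. }
  exists h. split; [| exact Inc].
  assert (Tot : forall i, exists x, ⟨i, x⟩ ∈ h).
  { sigma_ind [h] (@nil num).
    - destruct (Next _ _ G0) as [y Hy]. exists y. apply h2, Hy.
    (* The count at [x + one] is [i + one], and [Next] finds an element of [Z] with that count. *)
    - intros i [x Hx]. apply h2 in Hx. destruct Hx as [Zx Gx].
      destruct (Next _ _ (In _ _ Zx Gx)) as [y Hy]. exists y. apply h2, Hy. }
  repeat split.
  - intros z Hz. apply h1 in Hz. destruct Hz as [i [x [-> [Zx _]]]]. eauto.
  - intros i _. destruct (Tot i) as [x Hx]. exists x. split; [exact Hx |].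
    intros y Hy. apply h2 in Hx, Hy. destruct Hx as [Zx Gx]. destruct Hy as [Zy Gy].
    (* Just after the smaller of two distinct values the count would be [i + one], yet at most the
       count [i] at the larger. *)
    destruct (classic (x = y)) as [E | E]; [exact E | exfalso].
    destruct (lt_or_gt _ _ E) as [L | L]; apply le_succ_lt in L;
      apply (lt_irrefl i), (lt_le_trans _ (i + one)); try apply lt_add_one.
    + apply (Mono _ _ _ _ L); auto.
    + apply (Mono _ _ _ _ L); auto.
  - intros i j x Hi Hj. apply h2 in Hi, Hj. apply (GF x); tauto.
  - intros x Zx. destruct (GT x) as [i Hi]. exists i. apply h2. auto.
Qed.

(** * Spaces and their closure relations *)

Lemma basic_set (A : space M) (n : num) : exists U : set, forall x, x ∈ U <-> in_basic A n x.
Proof. bounded_comp [nbhds A] [n]. Qed.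

(** Basic open sets exist by bounded comprehension, so the quantifier over sets reduces to one over
    indices. *)
Lemma closure_iff (A : space M) (cl : set) (y x : num) :
  is_closure_relation A cl -> y ∈ points A -> x ∈ points A ->
  ⟨y, x⟩ ∈ cl <-> forall n, in_basic A n y -> in_basic A n x.
Proof.
  intros [_ Hcl] Hy Hx. rewrite (Hcl y x Hy Hx). split.
  - intros H n. destruct (basic_set A n) as [U HU]. rewrite <- !HU.
    apply H. exists n. exact HU.
  - intros H U [n HU]. rewrite !HU. apply H.
Qed.

Lemma subspace_exists (A : space M) (Z : set) :
  Z ⊆ points A -> exists B, is_subspace B A /\ points B = Z.
Proof.
  intros HZ.
  destruct (relation_comprehension (fun x n => ⟨x, n⟩ ∈ nbhds A /\ x ∈ Z)) as [N [_ HN]].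
  { bounded_comp [nbhds A; Z] (@nil num). }
  (* This is [wit_domain] with bounded quantifiers: the code is unpacked one pair at a time. *)
  assert (EW : exists W : set, forall z, z ∈ W <-> z ∈ wit A /\
    exists a, a < z + one /\ exists l, l < z + one /\ z = ⟨a, l⟩ /\
    exists b, b < a + one /\ exists n, n < a + one /\ a = ⟨b, n⟩ /\
    exists x, x < b + one /\ exists m, m < b + one /\ b = ⟨x, m⟩ /\ x ∈ Z)
    by bounded_comp [wit A; Z] (@nil num).
  destruct EW as [W HW]. exists {| points := Z; nbhds := N; wit := W |}.
  split; [| reflexivity]. split; [exact HZ |]. split.
  - intros n x. apply HN.
  - intros z. simpl. rewrite HW. split.
    + intros [Hz [a [_ [l [_ [E [b [_ [n [_ [-> [x [_ [m [_ [-> Zx]]]]]]]]]]]]]]]].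
      split; [exact Hz |]. exists ⟨x, m, n⟩, l. split; [| exact E].
      exists x, m, n. auto.
    + intros [Hz [a [l [[x [m [n [Zx ->]]]] ->]]]]. split; [exact Hz |].
      destruct (pair_bounds ⟨x, m, n⟩ l), (pair_bounds ⟨x, m⟩ n), (pair_bounds x m).
      exists ⟨x, m, n⟩. split; [assumption |]. exists l. do 2 (split; [auto |]).
      exists ⟨x, m⟩. split; [assumption |]. exists n. do 2 (split; [auto |]).
      exists x. split; [assumption |]. exists m. auto.
Qed.

(** Basic open sets of the subspace are traces, so specialization between its points is
    unchanged. *)
Lemma subspace_closure (A B : space M) (cl : set) (y x : num) :
  is_closure_relation A cl -> is_subspace B A -> y ∈ points B -> x ∈ points B ->
  ⟨y, x⟩ ∈ cl <-> forall n, in_basic B n y -> in_basic B n x.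
Proof.
  intros Hcl [Hsub [Hin _]] Hy Hx. rewrite (closure_iff A); auto.
  split; intros H n; specialize (H n); rewrite ?Hin in *; tauto.
Qed.

Lemma not_specializes (B : space M) (y x : num) :
  ~ (forall n, in_basic B n y -> in_basic B n x) ->
  exists n, in_basic B n y /\ ~ in_basic B n x.
Proof.
  intros H. apply not_all_ex_not in H. destruct H as [n H]. exists n. tauto.
Qed.

Lemma specialization_T1 (B : space M) :
  (forall x y, x ∈ points B -> y ∈ points B -> x <> y ->
    exists n, in_basic B n x /\ ~ in_basic B n y) -> is_T1 B.
Proof.
  intros H x y Hx Hy Hxy.
  destruct (H x y Hx Hy Hxy) as [n Hn], (H y x Hy Hx (not_eq_sym Hxy)) as [m Hm].
  destruct (basic_set B n) as [U HU], (basic_set B m) as [V HV].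
  exists U, V. rewrite !HU, !HV. repeat split; try tauto; [exists n | exists m]; auto.
Qed.

Lemma indiscrete_of_specialization (B : space M) :
  (forall n x, in_basic B n x -> x ∈ points B) ->
  (forall x y n, x ∈ points B -> y ∈ points B -> in_basic B n x -> in_basic B n y) ->
  is_indiscrete B.
Proof.
  intros Hsub H U [n HU]. destruct (classic (exists x, x ∈ U)) as [[x Hx] | N].
  - right. intros y. rewrite HU in *. split; eauto.
  - left. eauto.
Qed.

(** * Segment topologies along an increasing enumeration *)

Section Enumerated.

Context (B : space M) (h : set).
Hypothesis Hsub : forall n x, in_basic B n x -> x ∈ points B.
Hypothesis Hinf : infinite (points B).
Hypothesis Hh : is_enumeration h (points B).
Hypothesis Hinc : forall i j x y, ⟨i, x⟩ ∈ h -> ⟨j, y⟩ ∈ h -> i < j -> x < y.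

Lemma enum_value (i : num) : exists x, x ∈ points B /\ ⟨i, x⟩ ∈ h.
Proof using Hh HM.
  destruct Hh as [[H1 H2] _]. destruct (H2 i I) as [x [Hx _]]. exists x.
  split; [| exact Hx]. destruct (H1 _ Hx) as [j [y [_ [Hy E]]]].
  apply pair_inj in E. destruct E as [_ ->]. exact Hy.
Qed.

Lemma enum_index (x : num) : x ∈ points B -> exists i, ⟨i, x⟩ ∈ h.
Proof using Hh. apply Hh. Qed.

Lemma enum_points (i x : num) : ⟨i, x⟩ ∈ h -> x ∈ points B.
Proof using Hh HM.
  intros Hx. destruct Hh as [[H1 _] _]. destruct (H1 _ Hx) as [j [y [_ [Hy E]]]].
  apply pair_inj in E. destruct E as [_ ->]. exact Hy.
Qed.

Lemma enum_functional (i x y : num) : ⟨i, x⟩ ∈ h -> ⟨i, y⟩ ∈ h -> x = y.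
Proof using Hh.
  intros Hx Hy. destruct Hh as [[_ H2] _]. destruct (H2 i I) as [z [_ Hz]].
  rewrite <- (Hz x Hx). apply Hz, Hy.
Qed.

Lemma enum_le (i j x y : num) : ⟨i, x⟩ ∈ h -> ⟨j, y⟩ ∈ h -> i <= j <-> x <= y.
Proof using Hinc Hh HM.
  intros Hi Hj. split.
  - intros [L | ->]; [left; eauto | right; eauto using enum_functional].
  - intros L. destruct (le_or_lt i j) as [L' | L']; [exact L' | exfalso].
    apply (lt_irrefl x), (le_lt_trans _ y); eauto.
Qed.

(** A nonempty basic open set is upward closed, hence the final segment from its least element.
    Conversely, the segment from [k + one] is any basic open set containing the point of index
    [k + one] but not that of index [k]. *)
Lemma final_segment_topology :
  (forall x y n, x ∈ points B -> y ∈ points B -> x < y -> in_basic B n x -> in_basic B n y) ->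
  (forall x y, x ∈ points B -> y ∈ points B -> x < y ->
    exists n, in_basic B n y /\ ~ in_basic B n x) ->
  has_final_segment_topology B.
Proof using Hsub Hinf Hh Hinc HM.
  intros Hup Hsep. split; [exact Hinf |]. exists h. split; [exact Hh |].
  assert (Hup' : forall x y n, y ∈ points B -> x <= y -> in_basic B n x -> in_basic B n y).
  { intros x y n Hy [L | <-] Hx; eauto. }
  intros U. split; (intros [H | H]; [left; exact H |]).
  - destruct H as [n Hn]. destruct (classic (exists x, x ∈ U)) as [E | E].
    2: { left. left. eauto. }
    right. destruct (least_element U E) as [x [Hx Hmin]]. apply Hn in Hx.
    destruct (enum_index x (Hsub _ _ Hx)) as [j Hj]. exists j.
    intros y. split.
    + intros Hy. assert (Hy' := proj1 (Hn y) Hy).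
      destruct (enum_index y (Hsub _ _ Hy')) as [i Hi]. exists i. split; [| exact Hi].
      apply (enum_le j i x y Hj Hi). destruct (le_or_lt x y) as [L | L]; [exact L |].
      destruct (Hmin y L Hy).
    + intros [i [L Hi]]. apply Hn, (Hup' x); eauto using enum_points.
      apply (enum_le j i x y Hj Hi), L.
  (* Index zero has no predecessor to separate from, but its segment is the whole space. *)
  - destruct H as [j Hj]. destruct (zero_or_succ j) as [-> | [k ->]].
    + left. right. intros x. rewrite Hj. split.
      * intros [i [_ Hi]]. eauto using enum_points.
      * intros Hx. destruct (enum_index x Hx) as [i Hi]. eauto using zero_le.
    + right. destruct (enum_value k) as [x [Hx hx]], (enum_value (k + one)) as [x' [Hx' hx']].
      destruct (Hsep x x' Hx Hx') as [n [Hn Hn']]; [eauto using lt_add_one |].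
      exists n. intros y. rewrite Hj. split.
      * intros [i [L Hi]]. apply (Hup' x'); eauto using enum_points.
        apply (enum_le _ _ _ _ hx' Hi), L.
      * intros Hy. destruct (enum_index y (Hsub _ _ Hy)) as [i Hi]. exists i.
        split; [| exact Hi]. destruct (le_or_lt (k + one) i) as [L | L]; [exact L | exfalso].
        apply Hn', (Hup' y); auto. apply (enum_le _ _ _ _ Hi hx), lt_succ_le, L.
Qed.

(** A basic open set is downward closed, hence cut off by the least point of its complement, if any.
    Conversely, separating the points of indices [j] and [j + one] yields the segment up to [j]. *)
Lemma initial_segment_topology :
  (forall x y n, x ∈ points B -> y ∈ points B -> x < y -> in_basic B n y -> in_basic B n x) ->
  (forall x y, x ∈ points B -> y ∈ points B -> x < y ->
    exists n, in_basic B n x /\ ~ in_basic B n y) ->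
  has_initial_segment_topology B.
Proof using Hsub Hinf Hh Hinc HM.
  intros Hdown Hsep. split; [exact Hinf |]. exists h. split; [exact Hh |].
  assert (Hdown' : forall x y n, x ∈ points B -> x <= y -> in_basic B n y -> in_basic B n x).
  { intros x y n Hx [L | ->] Hy; eauto. }
  intros U. split; (intros [H | H]; [left; exact H |]).
  - destruct H as [n Hn].
    assert (EC : exists C : set, forall x, x ∈ C <-> x ∈ points B /\ ~ x ∈ U)
      by bounded_comp [points B; U] (@nil num).
    destruct EC as [C HC]. destruct (classic (exists x, x ∈ C)) as [E | E].
    2: { left. right. intros x. split; [rewrite Hn; eauto |]. intros Hx. apply NNPP.
         intros H. apply E. exists x. apply HC. auto. }
    destruct (least_element C E) as [x [Hx Hmin]]. apply HC in Hx. destruct Hx as [Hx HxU].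
    destruct (enum_index x Hx) as [j Hj].
    assert (Hlt : forall y, y ∈ U -> y < x).
    { intros y Hy. destruct (le_or_lt x y) as [L | L]; [exfalso | exact L].
      apply HxU, Hn, (Hdown' x y); auto. apply Hn, Hy. }
    (* Here [j] is the index of the first point outside [U], so [U] is empty or ends at the
       predecessor of [j]. *)
    destruct (zero_or_succ j) as [-> | [k ->]].
    + left. left. intros y Hy. assert (Hy' := proj1 (Hn y) Hy).
      destruct (enum_index y (Hsub _ _ Hy')) as [i Hi].
      apply (lt_irrefl x), (le_lt_trans _ y); [| exact (Hlt y Hy)].
      apply (enum_le _ _ _ _ Hj Hi), zero_le.
    + right. exists k. intros y. split.
      * intros Hy. assert (Hy' := proj1 (Hn y) Hy).
        destruct (enum_index y (Hsub _ _ Hy')) as [i Hi]. exists i. split; [| exact Hi].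
        apply lt_succ_le. destruct (le_or_lt (k + one) i) as [L | L]; [exfalso | exact L].
        apply (lt_irrefl x), (le_lt_trans _ y); [| exact (Hlt y Hy)].
        apply (enum_le _ _ _ _ Hj Hi), L.
      * intros [i [L Hi]]. apply NNPP. intros H.
        apply (Hmin y); [| apply HC; eauto using enum_points].
        apply (Hinc i (k + one)); auto. apply lt_succ_le, L.
  - right. destruct H as [j Hj].
    destruct (enum_value j) as [x [Hx hx]], (enum_value (j + one)) as [x' [Hx' hx']].
    destruct (Hsep x x' Hx Hx') as [n [Hn Hn']]; [eauto using lt_add_one |].
    exists n. intros y. rewrite Hj. split.
    + intros [i [L Hi]]. apply (Hdown' y x); eauto using enum_points.
      apply (enum_le _ _ _ _ Hi hx), L.
    + intros Hy. destruct (enum_index y (Hsub _ _ Hy)) as [i Hi]. exists i.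
      split; [| exact Hi]. apply lt_succ_le.
      destruct (le_or_lt (j + one) i) as [L | L]; [exfalso | exact L].
      apply Hn', (Hdown' x' y); auto. apply (enum_le _ _ _ _ hx' Hi), L.
Qed.

End Enumerated.

(** * The equivalence *)

Lemma CAC_wGS_cl : CAC M -> wGS_cl M.
Proof.
  intros HC A HA Hinf [cl Hcl].
  assert (Hrefl : forall x, x ∈ points A -> ⟨x, x⟩ ∈ cl).
  { intros x Hx. apply (closure_iff A); auto. }
  assert (Htrans : forall x y z, ⟨x, y⟩ ∈ cl -> ⟨y, z⟩ ∈ cl -> ⟨x, z⟩ ∈ cl).
  { intros x y z Hxy Hyz.
    destruct (proj1 Hcl _ Hxy) as [x' [y' [Hx [Hy E]]]]. apply pair_inj in E.
    destruct E as [<- <-].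
    destruct (proj1 Hcl _ Hyz) as [y' [z' [_ [Hz E]]]]. apply pair_inj in E.
    destruct E as [<- <-].
    rewrite (closure_iff A) in *; auto. }
  assert (Sub : forall Z, Z ⊆ points A -> exists B, is_subspace B A /\ points B = Z /\
    (forall n x, in_basic B n x -> x ∈ Z) /\
    (forall x y, x ∈ Z -> y ∈ Z ->
      ⟨x, y⟩ ∈ cl <-> forall n, in_basic B n x -> in_basic B n y)).
  { intros Z HZ. destruct (subspace_exists A Z HZ) as [B [HB EB]]. exists B.
    split; [exact HB |]. split; [exact EB |]. split.
    - intros n x Hx. apply HB in Hx. rewrite <- EB. apply Hx.
    - intros x y Hx Hy. rewrite <- EB in *. apply (subspace_closure A); auto. }
  destruct (relation_comprehension (fun x y => x ∈ points A /\ y ∈ points A /\ ~ y < x /\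
    ⟨x, y⟩ ∈ cl /\ ⟨y, x⟩ ∈ cl)) as [R [HR1 HR2]].
  { bounded_comp [points A; cl] (@nil num). }
  assert (O : is_partial_order (points A) R).
  { repeat split.
    - intros z Hz. destruct (HR1 z Hz) as [x [y [E H]]]. exists x, y. tauto.
    - intros x Hx. apply HR2. repeat split; auto using lt_irrefl.
    - intros x y Hxy Hyx. apply HR2 in Hxy, Hyx.
      destruct (classic (x = y)) as [E | E]; [exact E |].
      destruct (lt_or_gt _ _ E); tauto.
    - intros x y z Hxy Hyz. apply HR2 in Hxy, Hyz. apply HR2.
      destruct Hxy as [Hx [Hy [L [C1 C2]]]]. destruct Hyz as [_ [Hz [L' [C3 C4]]]].
      repeat split; eauto. intros Lzx. destruct (le_or_lt x y) as [K | K]; [| tauto].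
      apply L'. eapply lt_le_trans; eauto. }
  destruct (HC (points A) R O Hinf) as [Y [Yinf [[Ysub Y1] | [Ysub Y1]]]].
  { destruct (Sub Y Ysub) as [B [HB [EB [Bsub Bcl]]]]. exists B. rewrite EB.
    split; [exact HB |]. split; [exact Yinf |]. left.
    apply indiscrete_of_specialization; rewrite EB; [exact Bsub |].
    intros x y n Hx Hy. apply Bcl; auto.
    destruct (Y1 x y Hx Hy) as [H | H]; apply HR2 in H; tauto. }
  (* Of two distinct indistinguishable points one is the smaller number, which makes them comparable
     in [R]; an antichain has no such pair. *)
  assert (T0 : forall x y, x ∈ Y -> y ∈ Y -> ⟨x, y⟩ ∈ cl -> ⟨y, x⟩ ∈ cl -> x = y).
  { intros x y Hx Hy H1 H2. destruct (classic (x = y)) as [E | E]; [exact E | exfalso].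
    destruct (Y1 x y Hx Hy E) as [N1 N2]. rewrite HR2 in N1, N2.
    assert (Ax := Ysub x Hx). assert (Ay := Ysub y Hy).
    destruct (le_or_lt x y) as [L | L].
    - apply N1. repeat split; auto. intros L'. apply (lt_irrefl x).
      eapply le_lt_trans; eauto.
    - apply N2. repeat split; auto. intros L'. apply (lt_irrefl x).
      eapply le_lt_trans; [left; exact L' | exact L]. }
  clear R HR1 HR2 O Y1.
  destruct (relation_comprehension (fun x y => x ∈ Y /\ y ∈ Y /\ ⟨x, y⟩ ∈ cl))
    as [R [HR1 HR2]].
  { bounded_comp [Y; cl] (@nil num). }
  assert (O : is_partial_order Y R).
  { repeat split.
    - intros z Hz. destruct (HR1 z Hz) as [x [y [E H]]]. exists x, y. tauto.
    - intros x Hx. apply HR2. auto.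
    - intros x y Hxy Hyx. apply HR2 in Hxy, Hyx. apply T0; tauto.
    - intros x y z Hxy Hyz. apply HR2 in Hxy, Hyz. apply HR2.
      repeat split; try tauto. apply (Htrans x y z); tauto. }
  destruct (HC Y R O Yinf) as [L [Linf [[Lsub L1] | [Lsub L1]]]].
  2: { destruct (Sub L) as [B [HB [EB [Bsub Bcl]]]].
       { intros x Hx. apply Ysub, Lsub, Hx. }
       exists B. rewrite EB. split; [exact HB |]. split; [exact Linf |].
       right. right. right. apply specialization_T1. rewrite EB.
       intros x y Hx Hy Hxy. apply not_specializes. rewrite <- Bcl; auto.
       intros H. apply (proj1 (L1 x y Hx Hy Hxy)), HR2. auto. }
  assert (Tot : forall x y, x ∈ L -> y ∈ L -> ⟨x, y⟩ ∈ cl \/ ⟨y, x⟩ ∈ cl).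
  { intros x y Hx Hy. destruct (L1 x y Hx Hy) as [H | H]; apply HR2 in H; tauto. }
  clear R HR1 HR2 O L1.
  destruct (relation_comprehension (fun x y => x ∈ L /\ y ∈ L /\ ~ y < x /\ ⟨x, y⟩ ∈ cl))
    as [R [HR1 HR2]].
  { bounded_comp [L; cl] (@nil num). }
  assert (O : is_partial_order L R).
  { repeat split.
    - intros z Hz. destruct (HR1 z Hz) as [x [y [E H]]]. exists x, y. tauto.
    - intros x Hx. apply HR2. repeat split; auto using lt_irrefl.
    - intros x y Hxy Hyx. apply HR2 in Hxy, Hyx.
      destruct (classic (x = y)) as [E | E]; [exact E |].
      destruct (lt_or_gt _ _ E); tauto.
    - intros x y z Hxy Hyz. apply HR2 in Hxy, Hyz. apply HR2.
      destruct Hxy as [Hx [Hy [L1 C1]]]. destruct Hyz as [_ [Hz [L2 C2]]].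
      repeat split; eauto. intros Lzx. destruct (le_or_lt x y) as [K | K]; [| tauto].
      apply L2. eapply lt_le_trans; eauto. }
  destruct (HC L R O Linf) as [D [Dinf HD]].
  assert (Dsub : D ⊆ L) by (destruct HD as [[H _] | [H _]]; exact H).
  destruct (Sub D) as [B [HB [EB [Bsub Bcl]]]].
  { intros x Hx. apply Ysub, Lsub, Dsub, Hx. }
  destruct (increasing_enumeration D Dinf) as [h [Hh Hinc]].
  exists B. split; [exact HB |]. rewrite EB. split; [exact Dinf |]. right.
  assert (T0' : forall x y, x ∈ D -> y ∈ D -> x < y -> ⟨x, y⟩ ∈ cl -> ~ ⟨y, x⟩ ∈ cl).
  { intros x y Hx Hy Lxy H1 H2. assert (E : x = y) by (apply T0; auto).
    subst y. exact (lt_irrefl x Lxy). }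
  assert (Asym : forall x y : num, x < y -> ~ y < x).
  { intros x y H1 H2. apply (lt_irrefl x). eapply lt_le_trans; [exact H1 | left; exact H2]. }
  rewrite <- EB in *. destruct HD as [[_ HD] | [_ HD]].
  - right. left.
    (* As [R] respects [<=], comparability leaves only this direction. Open sets are therefore
       upward closed, and [T0'] provides the separation. *)
    assert (Up : forall x y, x ∈ points B -> y ∈ points B -> x < y -> ⟨x, y⟩ ∈ cl).
    { intros x y Hx Hy Lxy. destruct (HD x y Hx Hy) as [H | H]; apply HR2 in H; [tauto |].
      destruct H as [_ [_ [H _]]]. contradiction. }
    apply (final_segment_topology B h); auto.
    + intros x y n Hx Hy Lxy. apply Bcl; auto.
    + intros x y Hx Hy Lxy. apply not_specializes. rewrite <- Bcl; auto.
  - left.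
    (* Combined with [Tot], this reverses [cl] against [<], so open sets are downward closed. *)
    assert (Down : forall x y, x ∈ points B -> y ∈ points B -> x < y -> ~ ⟨x, y⟩ ∈ cl).
    { intros x y Hx Hy Lxy H. assert (E : x <> y).
      { intros ->. exact (lt_irrefl y Lxy). }
      apply (proj1 (HD x y Hx Hy E)), HR2. auto. }
    apply (initial_segment_topology B h); auto.
    + intros x y n Hx Hy Lxy. apply Bcl; auto.
      destruct (Tot x y) as [H | H]; auto. destruct (Down x y Hx Hy Lxy H).
    + intros x y Hx Hy Lxy. apply not_specializes. rewrite <- Bcl; auto.
Qed.

(* The Alexandrov topology of the order: [U_p] is the up-set of [p], and
   [k(x, m, n) = x]. *)
Lemma alexandrov_space (P R : set) :
  is_partial_order P R ->
  exists A, is_CSC A /\ points A = P /\ is_closure_relation A R /\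
    forall n x, in_basic A n x <-> ⟨n, x⟩ ∈ R.
Proof.
  intros [R1 [R2 [R3 R4]]].
  assert (RP : forall x y, ⟨x, y⟩ ∈ R -> x ∈ P /\ y ∈ P).
  { intros x y H. destruct (R1 _ H) as [x' [y' [Hx [Hy E]]]]. apply pair_inj in E.
    destruct E as [-> ->]. auto. }
  destruct (relation_comprehension (fun x n => ⟨n, x⟩ ∈ R)) as [N [_ HN]].
  { bounded_comp [R] (@nil num). }
  destruct (relation_comprehension (fun a l =>
    exists b, b < a + one /\ exists n, n < a + one /\ a = ⟨b, n⟩ /\
    exists x, x < b + one /\ exists m, m < b + one /\ b = ⟨x, m⟩ /\ x ∈ P /\ l = x))
    as [W [HW1 HW2]].
  { bounded_comp [P] (@nil num). }
  assert (HW : forall x m n l, ⟨⟨x, m, n⟩, l⟩ ∈ W <-> x ∈ P /\ l = x).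
  { intros x m n l. rewrite HW2. split.
    - intros [b [_ [n' [_ [E [x' [_ [m' [_ [-> H]]]]]]]]]]. apply triple_inj in E.
      destruct E as [-> _]. exact H.
    - intros H. destruct (pair_bounds ⟨x, m⟩ n), (pair_bounds x m).
      exists ⟨x, m⟩. split; [assumption |]. exists n. do 2 (split; [auto |]).
      exists x. split; [assumption |]. exists m. auto. }
  set (A := {| points := P; nbhds := N; wit := W |}).
  (* For [n] outside [P] the basic open set is empty, so every number may serve as an index. *)
  assert (HA : forall n x, in_basic A n x <-> ⟨n, x⟩ ∈ R) by (intros n x; apply HN).
  exists A. split; [| split; [reflexivity | split; [| exact HA]]].
  - split.
    + intros n x Hx. apply HA, RP in Hx. apply Hx.
    + intros x Hx. exists x. apply HA, R2, Hx.
    + split.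
      * intros z Hz. destruct (HW1 z Hz) as [a [l [-> [b [_ [n [_ [-> H]]]]]]]].
        destruct H as [x [_ [m [_ [-> [Hx _]]]]]]. exists ⟨x, m, n⟩, l.
        repeat split. exists x, m, n. auto.
      * intros a [x [m [n [Hx ->]]]]. exists x. split; [apply HW; auto |].
        intros l Hl. apply HW in Hl. symmetry. apply Hl.
    (* By transitivity, the up-set of [x] lies in every up-set of the family that contains [x]. *)
    + intros x m n l Hm Hn Hl. apply HW in Hl. destruct Hl as [Hx ->].
      rewrite HA in *. split; [apply R2, Hx |].
      intros y Hy. apply HA in Hy. rewrite !HA. eauto.
  - split; [exact R1 |]. intros y x Hy Hx. split.
    + intros H U [n Hn]. rewrite !Hn, !HA. eauto.
    (* The up-set of [y] is its least neighbourhood, so it is the only one to test. *)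
    + intros H. destruct (basic_set A y) as [U HU].
      apply HA, HU, H; [exists y; exact HU | apply HU, HA, R2, Hy].
Qed.

(** In a subspace of the Alexandrov space, the trace of the up-set of [x] is the least basic
    neighbourhood of [x]. The topology found therefore decides which points lie above [x]. *)
Lemma wGS_cl_CAC : wGS_cl M -> CAC M.
Proof.
  intros HW P R HR Hinf.
  destruct (alexandrov_space P R HR) as [A [HA [EA [Hcl Hin]]]].
  destruct (HW A HA) as [B [HB [Binf H]]]; [rewrite EA; exact Hinf | eauto |].
  destruct HB as [Bsub [Bin _]]. rewrite EA in Bsub. destruct HR as [_ [R2 [R3 R4]]].
  assert (Bin' : forall n x, in_basic B n x <-> ⟨n, x⟩ ∈ R /\ x ∈ points B).
  { intros n x. rewrite Bin, Hin. reflexivity. }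
  assert (Bself : forall x, x ∈ points B -> in_basic B x x).
  { intros x Hx. apply Bin'. auto. }
  exists (points B). split; [exact Binf |].
  destruct H as [H | [[_ [h [Hh H]]] | [[_ [h [Hh H]]] | H]]].
  (* Indiscreteness relates all points of [B] both ways, and antisymmetry would leave only one
     point. *)
  - exfalso.
    assert (Triv : forall x y, x ∈ points B -> y ∈ points B -> ⟨x, y⟩ ∈ R).
    { intros x y Hx Hy. destruct (basic_set B x) as [U HU].
      destruct (H U) as [E | E]; [exists x; exact HU | |].
      - destruct (E x). apply HU, Bself, Hx.
      - apply Bin', HU, E, Hy. }
    destruct (Binf zero) as [x [_ Hx]], (Binf x) as [y [L Hy]].
    assert (E : x = y) by auto. subst y. exact (lt_irrefl x L).
  - left. split; [exact Bsub |].
    (* The least neighbourhood of [y] is the whole space or an initial segment reaching its index,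
       so earlier points lie above later ones in the order. *)
    assert (Le : forall i j x y, ⟨i, x⟩ ∈ h -> ⟨j, y⟩ ∈ h -> x ∈ points B -> y ∈ points B ->
      i <= j -> ⟨y, x⟩ ∈ R).
    { intros i j x y Hi Hj Hx Hy L. destruct (basic_set B y) as [U HU].
      assert (Uy : y ∈ U) by apply HU, Bself, Hy.
      apply Bin', HU. destruct (proj1 (H U)) as [[E | E] | [k E]].
      - right. exists y. exact HU.
      - destruct (E y Uy).
      - apply E, Hx.
      - apply E in Uy. destruct Uy as [j' [L' Hj']]. apply E. exists i.
        split; [| exact Hi]. rewrite (proj1 (proj2 Hh) _ _ _ Hj' Hj) in L'.
        eapply le_trans; eauto. }
    intros x y Hx Hy. destruct (proj2 (proj2 Hh) x Hx) as [i Hi].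
    destruct (proj2 (proj2 Hh) y Hy) as [j Hj].
    destruct (le_or_lt i j) as [L | L]; [right | left]; eapply Le; eauto. left. exact L.
  - left. split; [exact Bsub |].
    assert (Le : forall i j x y, ⟨i, x⟩ ∈ h -> ⟨j, y⟩ ∈ h -> x ∈ points B -> y ∈ points B ->
      i <= j -> ⟨x, y⟩ ∈ R).
    { intros i j x y Hi Hj Hx Hy L. destruct (basic_set B x) as [U HU].
      assert (Ux : x ∈ U) by apply HU, Bself, Hx.
      apply Bin', HU. destruct (proj1 (H U)) as [[E | E] | [k E]].
      - right. exists x. exact HU.
      - destruct (E x Ux).
      - apply E, Hy.
      - apply E in Ux. destruct Ux as [i' [L' Hi']]. apply E. exists j.
        split; [| exact Hj]. rewrite (proj1 (proj2 Hh) _ _ _ Hi' Hi) in L'.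
        eapply le_trans; eauto. }
    intros x y Hx Hy. destruct (proj2 (proj2 Hh) x Hx) as [i Hi].
    destruct (proj2 (proj2 Hh) y Hy) as [j Hj].
    destruct (le_or_lt i j) as [L | L]; [left | right]; eapply Le; eauto. left. exact L.
  - right. split; [exact Bsub |].
    (* If [y] were above [x], every basic open set containing [x] would contain [y]. *)
    assert (Inc : forall x y, x ∈ points B -> y ∈ points B -> x <> y -> ~ ⟨x, y⟩ ∈ R).
    { intros x y Hx Hy Hxy Rxy.
      destruct (H x y Hx Hy Hxy) as [U [_ [[n HU] [_ [[Ux _] [_ Uy]]]]]].
      rewrite HU, Bin' in Ux, Uy. apply Uy. split; [| exact Hy].
      apply (R4 n x y); [apply Ux | exact Rxy]. }
    intros x y Hx Hy Hxy. split; apply Inc; auto.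
Qed.

End Model.

Theorem theorem4p7 (M : L2_structure) (HM : RCA0 M) : CAC M <-> wGS_cl M.
Proof. split; [apply CAC_wGS_cl, HM | apply wGS_cl_CAC, HM]. Qed.
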